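(* Let $k$ be a positive integer and let $p$ be a prime with $p\equiv 3 \pmod 4$. Let $r$ be a non-negative integer such that $p$ divides $4r+3$. Then for all integers $n\geq 0$, $$\bar{B}_{5,4}\left(4p^{k+1}n+4pr+3p\right)\equiv f(p)\cdot \bar{B}_{5,4}\left(4p^{k-1}n+\frac{4r+3}{p}\right) \pmod 4,$$ where $f(p)=-1$ if $p\equiv 3,7 \pmod{20}$ and $f(p)=1$ if $p\equiv 11,19 \pmod{20}$.
   Context: An overpartition of a positive integer $n$ is a partition of $n$ in which the first occurrence of each distinct part may be overlined. For coprime integers $\ell_1,\ell_2>1$, $\bar{B}_{\ell_1,\ell_2}(n)$ denotes the number of overpartitions of $n$ in which no part is divisible by $\ell_1$ or by $\ell_2$, with $\bar{B}_{\ell_1,\ell_2}(0)=1$. *)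

(* Defs.v *)
From mathcomp Require Import all_boot all_order all_algebra.

Set Implicit Arguments.
Unset Strict Implicit.
Unset Printing Implicit Defensive.

(* An overpartition is listed as its parts in non-increasing order, each paired *)
(* with a flag telling whether it is overlined; the last condition allows only  *)
(* the first occurrence of each part size to be overlined.                      *)
Definition is_overpartition (n : nat) (s : seq (nat * bool)) : bool :=
  [&& sorted geq (unzip1 s),
      all (fun a => 0 < a) (unzip1 s),
      sumn (unzip1 s) == n &
      [forall i : 'I_(size s), (nth (0, false) s i).2 ==>
         ((nth (0, false) s i).1 \notin take i (unzip1 s))]].

Definition regular2 (l1 l2 : nat) (s : seq (nat * bool)) : bool :=
  all (fun a => ~~ (l1 %| a) && ~~ (l2 %| a)) (unzip1 s).

Definition seq_of_bseq (n : nat) (s : n.-bseq ('I_n.+1 * bool)) :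
  seq (nat * bool) := [seq (nat_of_ord x.1, x.2) | x <- s].

(* The finite type n.-bseq ('I_n.+1 * bool) loses nothing: an overpartition of  *)
(* n has at most n parts, each of size at most n.                               *)
Lemma is_overpartition_bseq (n : nat) (s : seq (nat * bool)) :
  is_overpartition n s ->
  exists t : n.-bseq ('I_n.+1 * bool), seq_of_bseq t = s.
Proof.
case/and4P=> _ pos_s /eqP sum_s _.
have size_s : size s <= n.
  rewrite -sum_s; elim: s pos_s {sum_s} => //= x s IHs /andP[x_gt0 /IHs le_s].
  by rewrite -addn1 addnC leq_add.
have le_n : all (fun x : nat * bool => x.1 < n.+1) s.
  rewrite -sum_s; elim: s {pos_s sum_s size_s} => //= x s IHs.
  rewrite ltnS leq_addr /=; apply: sub_all IHs => y /= le_y.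
  by apply: leq_trans le_y _; rewrite ltnS leq_addl.
have size_t : size [seq (inord x.1 : 'I_n.+1, x.2) | x <- s] <= n.
  by rewrite size_map.
exists (Bseq size_t); rewrite /seq_of_bseq /= -map_comp.
apply: map_id_in => -[a b] /(allP le_n) /= lt_a.
by rewrite inordK.
Qed.

Lemma seq_of_bseq_inj (n : nat) : injective (@seq_of_bseq n).
Proof.
move=> s t eq_st; apply: val_inj; apply: inj_map eq_st.
by move=> [a b] [c d] [/= /val_inj -> ->].
Qed.

Definition Bbar (l1 l2 n : nat) : nat :=
  #|[set s : n.-bseq ('I_n.+1 * bool) |
      is_overpartition n (seq_of_bseq s) && regular2 l1 l2 (seq_of_bseq s)]|.

(* The value 0 is never reached for a prime p congruent to 3 modulo 4.          *)
Definition f (p : nat) : int :=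
  if p %% 20 \in [:: 3; 7] then (-1)%R
  else if p %% 20 \in [:: 11; 19] then 1%R
  else 0%R.

(* Main.v *)
Require Import Defs.
From mathcomp Require Import all_boot all_order all_algebra.
From mathcomp Require Import zify.

Set Implicit Arguments.
Unset Strict Implicit.
Unset Printing Implicit Defensive.

(** Toggling the overline of the largest part pairs up the overpartitions of
    [n > 0].  Among those whose largest part is not overlined, toggling the
    overline of the second largest part size is an involution defined except
    when all parts are equal, so their number has the parity of the number
    [t n] of admissible divisors of [n]: the number of overpartitions is
    [2 * t n] modulo 4.  Finally, multiplication by [p] is a bijection from the
    admissible divisors of [p * N] not dividing [N] to those of [p ^ 2 * N] not
    dividing [p * N], so [t (p ^ 2 * N)] and [t N] have the same parity; the
    sign [f p] is harmless because both counts are even. *)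

(** * Counting a duplicate-free list by means of an involution *)

(** Points moved by [h] come in pairs. Strong induction on the size removes the head alone if it is
    fixed, and together with its partner otherwise. *)
Lemma odd_size_involution (T : eqType) (h : T -> T) (u : seq T) :
    uniq u -> {in u, forall x, h x \in u} -> {in u, involutive h} ->
  odd (size u) = odd (count (fun x => h x == x) u).
Proof.
move: {2}(size u).+1 (ltnSn (size u)) => m.
elim: m u => // m IHm [|x u] //; rewrite [size _]/= !ltnS => le_u.
rewrite [uniq _]/= => /andP[xNu uniq_u] hu hK.
have hx := hu x (mem_head _ _); have hhx := hK x (mem_head _ _).
have [fix_x | mov_x] := eqVneq (h x) x.
  rewrite /= fix_x eqxx add1n /= (IHm u) // => y yu.
    have := hu y (mem_behead (s := x :: u) yu); rewrite inE => /predU1P[hy|//].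
    have := hK y (mem_behead (s := x :: u) yu); rewrite hy fix_x => xy.
    by rewrite xy yu in xNu.
  exact/hK/(mem_behead (s := x :: u)).
have hxu : h x \in u by move: hx; rewrite inE (negPf mov_x).
have permu := perm_to_rem hxu.
have sub_rem y : y \in rem (h x) u -> y \in x :: u.
  by move/mem_rem=> yu; rewrite inE yu orbT.
have szu : size u = (size (rem (h x) u)).+1 by rewrite (perm_size permu).
rewrite /= (negPf mov_x) add0n szu (permP permu) /= hhx eq_sym (negPf mov_x).
rewrite add0n negbK; apply: IHm => [||y yr|y yr].
- by rewrite szu in le_u; apply: ltnW.
- exact: rem_uniq.
- have yu := mem_rem yr; have := hu y (sub_rem y yr).
  rewrite mem_rem_uniq // !inE => /predU1P[hy | hyu].
    have := hK y (sub_rem y yr); rewrite hy => yx.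
    by move: yr; rewrite mem_rem_uniq // inE yx eqxx.
  (* [h y = h x] would force [y = x], so the list without the pair stays stable under [h]. *)
  rewrite hyu andbT; apply/eqP => /(congr1 h).
  rewrite hhx hK ?sub_rem // => yx; by rewrite -yx yu in xNu.
- exact/hK/sub_rem.
Qed.

(** [h] maps the elements satisfying [a] bijectively onto the others. *)
Lemma size_toggle (T : eqType) (h : T -> T) (a : pred T) (u : seq T) :
    uniq u -> {in u, forall x, h x \in u} -> {in u, involutive h} ->
    {in u, forall x, a (h x) = ~~ a x} ->
  size u = (count a u).*2.
Proof.
move=> uniq_u hu hK ha; rewrite -(count_predC a u) -addnn; congr (_ + _).
rewrite -!size_filter -(size_map h (filter a u)); apply: perm_size.
apply: uniq_perm; first exact: filter_uniq.
  rewrite map_inj_in_uniq ?filter_uniq // => x y.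
  rewrite !mem_filter => /andP[_ xu] /andP[_ yu] eq_h.
  by rewrite -(hK x xu) eq_h hK.
move=> x; apply/idP/mapP.
  rewrite mem_filter /= => /andP[ax xu]; exists (h x); rewrite ?hK //.
  by rewrite mem_filter ha // ax hu.
case=> y; rewrite mem_filter => /andP[ay yu] ->.
by rewrite mem_filter /= ha // ay hu.
Qed.

(** * Overpartitions as plain sequences, and toggling one overline *)

Definition overpartitions (l1 l2 n : nat) : seq (seq (nat * bool)) :=
  [seq seq_of_bseq s | s <- enum [set s : n.-bseq ('I_n.+1 * bool) |
      is_overpartition n (seq_of_bseq s) && regular2 l1 l2 (seq_of_bseq s)]].

Lemma size_overpartitions l1 l2 n : size (overpartitions l1 l2 n) = Bbar l1 l2 n.
Proof. by rewrite size_map -cardE. Qed.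

Lemma overpartitions_uniq l1 l2 n : uniq (overpartitions l1 l2 n).
Proof. by rewrite map_inj_uniq ?enum_uniq //; apply: seq_of_bseq_inj. Qed.

Lemma mem_overpartitions l1 l2 n s :
  (s \in overpartitions l1 l2 n) = is_overpartition n s && regular2 l1 l2 s.
Proof.
apply/mapP/idP => [[t] | /andP[ov_s reg_s]].
  by rewrite mem_enum inE => valid_t ->.
have [t def_s] := is_overpartition_bseq ov_s.
by exists t; rewrite ?mem_enum ?inE ?def_s ?ov_s.
Qed.

(** Only the first occurrence of [x] changes its flag. If [x] does not occur, [index] is the size of
    [s] and nothing changes. *)
Definition flip (x : nat) (s : seq (nat * bool)) : seq (nat * bool) :=
  mkseq (fun i => ((nth (0, false) s i).1,
                   (nth (0, false) s i).2 (+) (i == index x (unzip1 s)))) (size s).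

Lemma size_flip x s : size (flip x s) = size s.
Proof. exact: size_mkseq. Qed.

Lemma nth_flip x s i : i < size s ->
  nth (0, false) (flip x s) i =
    ((nth (0, false) s i).1,
     (nth (0, false) s i).2 (+) (i == index x (unzip1 s))).
Proof. by move=> lt_i; rewrite nth_mkseq. Qed.

Lemma unzip1_flip x s : unzip1 (flip x s) = unzip1 s.
Proof.
apply: (@eq_from_nth _ 0); rewrite !size_map ?size_iota // => i lt_i.
rewrite (nth_map (0, false)) ?size_flip // nth_flip //=.
by rewrite (nth_map (0, false)).
Qed.

Lemma flipK x : involutive (flip x).
Proof.
move=> s; apply: (@eq_from_nth _ (0, false)); rewrite !size_flip // => i lt_i.
rewrite nth_flip ?size_flip // nth_flip //= unzip1_flip addbK.
by case: (nth _ s i).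
Qed.

Lemma flip_neq (x : nat) (s : seq (nat * bool)) : x \in unzip1 s -> flip x s != s.
Proof.
rewrite -index_mem size_map => lt_i; apply/eqP.
move/(congr1 (fun t => (nth (0, false) t (index x (unzip1 s))).2)).
by rewrite nth_flip //= eqxx addbT; case: (_.2).
Qed.

Lemma flip_overpartitions l1 l2 n x s :
  s \in overpartitions l1 l2 n -> flip x s \in overpartitions l1 l2 n.
Proof.
rewrite !mem_overpartitions /is_overpartition /regular2 unzip1_flip.
case/andP=> /and4P[-> -> -> /forallP ov] ->; rewrite !andbT /=.
apply/forallP=> -[i lt_i] /=; rewrite size_flip in lt_i.
rewrite nth_flip //=; have := ov (Ordinal lt_i); rewrite /=.
have [eq_i _ | _] := eqVneq i (index x (unzip1 s)); last by rewrite addbF.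
have xs : x \in unzip1 s by rewrite -index_mem size_map -eq_i.
apply/implyP=> _; rewrite -(nth_map _ 0) // -/(unzip1 s) eq_i nth_index //.
(* The toggled position is the first occurrence of [x], where an overline is allowed. *)
by rewrite in_take ?index_size // ltnn.
Qed.

(** * Overpartitions modulo 4 and admissible divisors *)

Definition divisor_count (l1 l2 n : nat) : nat :=
  count (fun d => ~~ (l1 %| d) && ~~ (l2 %| d)) (divisors n).

Definition head_plain (s : seq (nat * bool)) : bool := ~~ (head (0, false) s).2.

(** In a non-increasing list this is the second largest part size. The default 0, reached when [u]
    is constant, is avoided by [flip_second]. *)
Definition second_part (u : seq nat) : nat := nth 0 u (find (predC1 (head 0 u)) u).

Definition flip_second (s : seq (nat * bool)) : seq (nat * bool) :=
  if constant (unzip1 s) then s else flip (second_part (unzip1 s)) s.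

Lemma second_partP u : ~~ constant u ->
  (second_part u \in u) /\ second_part u != head 0 u.
Proof.
case: u => //= x u; rewrite -has_predC => has_u.
have has_xu : has (predC1 x) (x :: u) by rewrite /= eqxx.
split; first by rewrite mem_nth // -has_find.
exact: (nth_find 0 has_xu).
Qed.

(** Part sizes are unchanged by [flip], so the second application takes the same branch and toggles
    the same part. *)
Lemma flip_secondK : involutive flip_second.
Proof.
move=> s; rewrite /flip_second.
have [const_s | nconst_s] := boolP (constant (unzip1 s)); first by rewrite const_s.
by rewrite unzip1_flip (negPf nconst_s) flipK.
Qed.

Lemma flip_second_fix s : (flip_second s == s) = constant (unzip1 s).
Proof.
rewrite /flip_second; case: ifPn => [_|/second_partP[mem_s _]]; first exact: eqxx.
exact: negPf (flip_neq mem_s).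
Qed.

Lemma head_plain_flip_second s : head_plain (flip_second s) = head_plain s.
Proof.
rewrite /flip_second; case: ifPn => // /second_partP[_].
case: s => // -[x b] s /= neq_x; rewrite /head_plain -nth0 nth_flip //=.
by rewrite (eq_sym x) (negPf neq_x) addbF.
Qed.

Lemma head_plain_flip_head s : s != [::] ->
  head_plain (flip (head 0 (unzip1 s)) s) = ~~ head_plain s.
Proof.
case: s => // -[x b] s _; rewrite /head_plain -nth0 nth_flip //=.
by rewrite eqxx addbT.
Qed.

Lemma overpartitions_neq_nil l1 l2 n s : 0 < n ->
  s \in overpartitions l1 l2 n -> s != [::].
Proof.
rewrite mem_overpartitions => n_gt0 /andP[/and4P[_ _ /eqP sum_s _] _].
by apply: contraTneq n_gt0 => s0; rewrite -sum_s s0.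
Qed.

Lemma nseq_overpartitions l1 l2 n m d : 0 < n ->
  (nseq m (d, false) \in overpartitions l1 l2 n) =
    (d * m == n) && (~~ (l1 %| d) && ~~ (l2 %| d)).
Proof.
move=> n_gt0; rewrite mem_overpartitions /is_overpartition /regular2.
have -> : unzip1 (nseq m (d, false)) = nseq m d by rewrite /unzip1 map_nseq.
rewrite sumn_nseq !all_nseq.
have -> : sorted geq (nseq m d).
  by case: m => //= m; elim: m => //= m ->; rewrite leqnn.
have -> : [forall i : 'I_(size (nseq m (d, false))),
    (nth (0, false) (nseq m (d, false)) i).2 ==>
    ((nth (0, false) (nseq m (d, false)) i).1 \notin take i (nseq m d))].
  by apply/forallP=> i; rewrite nth_nseq; case: ifP.
rewrite andbT /= [_ && (_ == n)]andbC -!andbA.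
(* As [n > 0], the equation [d * m = n] already makes [d] and [m] positive. *)
case: eqP => //= dm_n; move: n_gt0; rewrite -dm_n muln_gt0 => /andP[-> m_gt0].
by rewrite orbT -(negbK (m == 0)) -lt0n m_gt0.
Qed.

Lemma constant_overpartition l1 l2 n s :
    s \in overpartitions l1 l2 n -> head_plain s -> constant (unzip1 s) ->
  s = nseq (size s) (head 0 (unzip1 s), false).
Proof.
rewrite mem_overpartitions => /andP[/and4P[_ _ _ /forallP ov] _].
move=> plain_s const_s; apply/all_pred1P/(all_nthP (0, false)) => i lt_i.
have fst_s j : j < size s -> (nth (0, false) s j).1 = head 0 (unzip1 s).
  move=> lt_j; rewrite -(nth_map _ 0) //.
  case: s const_s lt_j {plain_s ov lt_i} => //= x s /all_pred1P us.
  rewrite ltnS => lt_j.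
  by case: j lt_j => //= j lt_j; rewrite [map _ _]us nth_nseq size_map lt_j.
have := ov (Ordinal lt_i); rewrite /= fst_s //.
have -> : nth (0, false) s i = (head 0 (unzip1 s), (nth (0, false) s i).2).
  by rewrite -(fst_s i) //; case: (nth _ s i).
case: i lt_i => [_ _ | i lt_i] /=.
  by move: plain_s; rewrite /head_plain -nth0 => /negPf ->.
(* Beyond position 0 the part repeats the head, so it cannot be overlined. *)
case: s lt_i {fst_s ov plain_s const_s} => //= -[x b] s lt_i.
by rewrite /= inE eqxx implybF => /negPf ->.
Qed.

(** A plain overpartition with all parts equal to [d] corresponds to the divisor [d]; its
    multiplicity must be [n / d]. *)
Lemma count_constant_overpartitions l1 l2 n : 0 < n ->
  count (fun s => head_plain s && constant (unzip1 s)) (overpartitions l1 l2 n)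
    = divisor_count l1 l2 n.
Proof.
move=> n_gt0; rewrite /divisor_count -!size_filter.
set A := filter _ _; rewrite -(size_map (fun s => head 0 (unzip1 s)) A).
have defA s : s \in A -> (s \in overpartitions l1 l2 n) /\
    s = nseq (size s) (head 0 (unzip1 s), false).
  rewrite mem_filter => /andP[/andP[plain_s const_s] ov_s]; split => //.
  exact: constant_overpartition ov_s plain_s const_s.
have sizeA s : s \in A -> head 0 (unzip1 s) * size s = n /\
    ~~ (l1 %| head 0 (unzip1 s)) && ~~ (l2 %| head 0 (unzip1 s)).
  case/defA=> ov_s def_s; move: ov_s; rewrite {1}def_s nseq_overpartitions //.
  by case/andP=> /eqP.
apply/perm_size/uniq_perm.
- rewrite map_inj_in_uniq ?filter_uniq ?overpartitions_uniq // => s t As At eq_h.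
  have [_ ->] := defA s As; have [_ ->] := defA t At.
  have [sn _] := sizeA s As; have [tn _] := sizeA t At.
  rewrite eq_h; congr (nseq _ _); apply/eqP.
  rewrite -(@eqn_pmul2l (head 0 (unzip1 t))); first by rewrite tn -eq_h sn.
  by move: n_gt0; rewrite -tn muln_gt0 => /andP[].
- by rewrite filter_uniq ?divisors_uniq.
move=> d; apply/mapP/idP => [[s As ->]|].
  have [sn reg] := sizeA s As.
  by rewrite mem_filter reg -dvdn_divisors // -sn dvdn_mulr.
rewrite mem_filter -dvdn_divisors // => /andP[reg /dvdnP[m def_n]].
have m_gt0 : 0 < m by move: n_gt0; rewrite def_n muln_gt0 => /andP[].
exists (nseq m (d, false)); last by case: m m_gt0 {def_n}.
rewrite mem_filter nseq_overpartitions // reg mulnC -def_n eqxx /= andbT.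
case: m m_gt0 {def_n} => //= m _.
by rewrite /head_plain /unzip1 map_nseq all_pred1_nseq.
Qed.

(** Determines [Bbar] modulo 4: [b] counts the overpartitions with plain largest part, and
    [flip_second] acts on these with the constant ones as fixed points. *)
Lemma Bbar_divisor_count l1 l2 n : 0 < n ->
  exists2 b, Bbar l1 l2 n = b.*2 & odd b = odd (divisor_count l1 l2 n).
Proof.
move=> n_gt0; set U := overpartitions l1 l2 n; exists (count head_plain U).
  rewrite -size_overpartitions.
  apply: (@size_toggle _ (fun s => flip (head 0 (unzip1 s)) s)).
  - exact: overpartitions_uniq.
  - by move=> s; apply: flip_overpartitions.
  - by move=> s _; rewrite unzip1_flip flipK.
  - by move=> s /(overpartitions_neq_nil n_gt0)/head_plain_flip_head.
rewrite -size_filter (@odd_size_involution _ flip_second).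
- rewrite count_filter -count_constant_overpartitions //; congr (odd _).
  by apply: eq_count => s /=; rewrite flip_second_fix andbC.
- by rewrite filter_uniq ?overpartitions_uniq.
- move=> s; rewrite !mem_filter head_plain_flip_second => /andP[-> sU] /=.
  by rewrite /flip_second; case: ifP => // _; apply: flip_overpartitions.
- by move=> s _; apply: flip_secondK.
Qed.

(** * Admissible divisors under multiplication by a prime *)

Lemma divisor_count_mul l1 l2 p n : 0 < p -> 0 < n ->
  divisor_count l1 l2 (p * n) = divisor_count l1 l2 n +
    count (fun d => ~~ (d %| n) && (~~ (l1 %| d) && ~~ (l2 %| d)))
          (divisors (p * n)).
Proof.
move=> p_gt0 n_gt0; have pn_gt0 : 0 < p * n by rewrite muln_gt0 p_gt0.
rewrite /divisor_count; set a := fun d => _ && ~~ (l2 %| d).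
rewrite -[in LHS]size_filter -(count_predC (dvdn^~ n)) !count_filter.
congr (_ + _); rewrite -!size_filter.
apply/perm_size/uniq_perm; rewrite ?filter_uniq ?divisors_uniq // => d.
rewrite !mem_filter -!dvdn_divisors //=.
by have [/dvdn_mull-> | _] := boolP (d %| n); rewrite ?andbF.
Qed.

Lemma odd_divisor_count_mulpp l1 l2 p n :
    prime p -> coprime l1 p -> coprime l2 p -> 0 < n ->
  odd (divisor_count l1 l2 (p * (p * n))) = odd (divisor_count l1 l2 n).
Proof.
move=> p_pr co1 co2 n_gt0; have p_gt0 := prime_gt0 p_pr.
have pn_gt0 : 0 < p * n by rewrite muln_gt0 p_gt0.
have ppn_gt0 : 0 < p * (p * n) by rewrite muln_gt0 p_gt0.
rewrite divisor_count_mul // divisor_count_mul // -addnA oddD.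
(* [E1] counts the divisors gained from [n] to [p * n], [E2] those gained from [p * n] to
   [p * (p * n)]; multiplication by [p] matches them. *)
set E1 := count _ _; set E2 := count _ _; suff -> : E2 = E1.
  by rewrite addnn odd_double addbF.
rewrite {}/E1 {}/E2 -!size_filter; apply/esym.
rewrite -(size_map (muln p)); apply/perm_size/uniq_perm.
- rewrite map_inj_in_uniq ?filter_uniq ?divisors_uniq // => x y _ _ /eqP.
  by rewrite eqn_pmul2l // => /eqP.
- by rewrite filter_uniq ?divisors_uniq.
have admM d : ~~ (l1 %| p * d) && ~~ (l2 %| p * d) = ~~ (l1 %| d) && ~~ (l2 %| d).
  by rewrite !Gauss_dvdr.
move=> e; apply/mapP/idP => [[d]|].
  rewrite !mem_filter -!dvdn_divisors // => dP ->.
  by rewrite admM !dvdn_pmul2l.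
rewrite mem_filter -dvdn_divisors // => eP.
(* A divisor of [p * (p * n)] prime to [p] divides [p * n] by Gauss, so a gained divisor is a
   multiple of [p]. *)
have /dvdnP[d def_e] : p %| e.
  apply: contraLR eP => pNe; rewrite -andbA andbC -!andbA.
  rewrite (Gauss_dvdr _ (m := e)); last by rewrite coprime_sym prime_coprime.
  by case: (e %| p * n); rewrite ?andbF.
exists d; last by rewrite mulnC.
move: eP; rewrite mem_filter -dvdn_divisors // def_e mulnC admM.
by rewrite !dvdn_pmul2l.
Qed.

Lemma Bbar_mulpp l1 l2 p n :
    prime p -> coprime l1 p -> coprime l2 p -> 0 < n ->
  exists b c, [/\ Bbar l1 l2 (p * (p * n)) = b.*2, Bbar l1 l2 n = c.*2
                & odd b = odd c].
Proof.
move=> p_pr co1 co2 n_gt0; have p_gt0 := prime_gt0 p_pr.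
have [|b Eb ob] := @Bbar_divisor_count l1 l2 (p * (p * n)).
  by rewrite !muln_gt0 p_gt0.
have [c Ec oc] := @Bbar_divisor_count l1 l2 n n_gt0.
by exists b, c; rewrite ob oc odd_divisor_count_mulpp.
Qed.

(** * The sign and the final congruence *)

(** Of the residues modulo 20 that are 3 modulo 4, only 15 has no sign; it would make 5 divide [p],
    hence [p = 5], which is 1 modulo 4. *)
Lemma f_pm1 p : prime p -> p = 3 %[mod 4] -> f p = 1%R \/ f p = (-1)%R.
Proof.
move=> p_pr p4; rewrite /f; have p20 : p %% 20 %% 4 = 3 by rewrite modn_dvdm.
have p5 : p %% 20 %% 5 != 0.
  rewrite modn_dvdm // -/(dvdn 5 p) dvdn_prime2 //.
  by apply: contra_eqN p4 => /eqP <-.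
have /allP residues : all (fun m => (m %% 4 == 3) && (m %% 5 != 0) ==>
    (m \in [:: 3; 7; 11; 19])) (iota 0 20) by [].
have := residues (p %% 20); rewrite mem_iota ltn_mod p20 p5 => /(_ isT).
rewrite /= in_cons in_cons in_cons mem_seq1.
by move=> /or4P[] /eqP ->; [right | right | left | left].
Qed.

Theorem theorem6p4 (k p r : nat) (hk : 0 < k) (hp : prime p)
    (hp4 : p = 3 %[mod 4]) (hr : p %| 4 * r + 3) (n : nat) :
  ((Bbar 5 4 (4 * p ^ (k + 1) * n + 4 * p * r + 3 * p))%:Z =
     f p * (Bbar 5 4 (4 * p ^ (k - 1) * n + (4 * r + 3) %/ p)%N)%:Z %[mod 4])%Z.
Proof.
have p_gt0 := prime_gt0 hp.
set N := 4 * p ^ (k - 1) * n + _.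
have -> : 4 * p ^ (k + 1) * n + 4 * p * r + 3 * p = p * (p * N).
  (* Writing [k] as a successor turns [k - 1] into a true predecessor; [divnK] uses [hr] to give
     [p * ((4 * r + 3) %/ p) = 4 * r + 3]. *)
  case: k hk @N => // k _; rewrite subn1 /= addn1 !expnS (mulnC 3).
  rewrite mulnDr [p * (_ %/ p)]mulnC divnK // mulnDr mulnDr addnA.
  by rewrite -!mulnA !(mulnCA 4 p).
have N_gt0 : 0 < N.
  by rewrite addn_gt0 divn_gt0 // (dvdn_leq _ hr) ?orbT // addn3.
have co5 : coprime 5 p.
  by rewrite prime_coprime // dvdn_prime2 //; apply: contra_eqN hp4 => /eqP <-.
have co4 : coprime 4 p.
  rewrite -[4]/(2 ^ 2) coprime_pexpl // prime_coprime // dvdn_prime2 //.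
  by apply: contra_eqN hp4 => /eqP <-.
have [b [c [-> -> obc]]] := @Bbar_mulpp 5 4 p N hp co5 co4 N_gt0.
(* With [b] and [c] of equal parity, [2b] is congruent to both [2c] and [-2c] modulo 4. *)
by have [-> | ->] := f_pm1 hp hp4; lia.
Qed.
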